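(* Let $N\ge1$, $p=2N+1$, $\alpha\ge0$, and let $\Psi(v)=(\lambda_k(\pi,0,v))_{k=-N}^N$ for $v\in\mathbb{R}^p$, where $\lambda_k(t,0,v)$ are the eigenvalues defined in the context. Let $$\hat{\mathcal{V}}_\alpha=\{v\in\mathbb{R}^p:\ 0\le v_1<v_2<\dots<v_{2N+1}\le\alpha\},\qquad \check{\mathcal{V}}_\alpha=\{v\in\mathbb{R}^p:\ \alpha\ge v_1>v_2>\dots>v_{2N+1}\ge0\}.$$ (i) The mapping $\Psi:\hat{\mathcal{V}}_\alpha\to\mathbb{R}^{2N+1}$ is an injection if and only if $\alpha\in[0,1]$. (ii) The mapping $\Psi:\check{\mathcal{V}}_\alpha\to\mathbb{R}^{2N+1}$ is an injection if and only if $\alpha\in[0,1]$. (iii) In both of these cases (i.e. $v\in\hat{\mathcal{V}}_\alpha$ or $v\in\check{\mathcal{V}}_\alpha$ with $\alpha\in[0,1]$) there exists an algorithm recovering $v$ from $\Psi(v)=(\lambda_k(\pi,0,v))_{k=-N}^N$. (iv) The functions $\lambda_k$, $k\in\{-N,\dots,N\}$, satisfy $\lambda_k(\pi+t,0,v)=\lambda_k(\pi-t,0,v)$ for any $(t,v)\in[0,\pi]\times\mathbb{R}^p$. If $v\in\hat{\mathcal{V}}_1$ or $v\in\check{\mathcal{V}}_1$, then the numbers $\lambda_k(\pi,0,v)$, $k\in\{-N,\dots,N\}$, are all distinct.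
   Context: For $t\in[0,2\pi]$ and $v=(v_k)_1^p\in\mathbb{R}^p$, $J_t(0,v)$ is the symmetric $p\times p$ Jacobi matrix with diagonal $v_1,\dots,v_p$ and off-diagonal entries $(J_t)_{n,n+1}=(J_t)_{n+1,n}=a_n$, $1\le n\le p-1$, where $a_n=1$ for $n$ even and $a_n=2|\cos\frac t2|$ for $n$ odd (this is the case of zero magnetic field $b=0$). Its eigenvalues are ordered as $\lambda_{-N}(t,0,v)\le\lambda_{-N+1}(t,0,v)\le\dots\le\lambda_N(t,0,v)$. *)

(* Defs.v *)
From HB Require Import structures.
From mathcomp Require Import all_boot all_order all_algebra.
From mathcomp Require Import complex.
From mathcomp Require Import all_classical all_reals all_analysis.

Set Implicit Arguments.
Unset Strict Implicit.
Unset Printing Implicit Defensive.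

Import Order.TTheory GRing.Theory Num.Theory.
Local Open Scope classical_set_scope.
Local Open Scope ring_scope.

(* Each eigenvalue is repeated according to its algebraic multiplicity. *)
Definition ordered_spectrum (R : realType) n (A : 'M[R]_n) : set (seq R) :=
  [set s | sorted <=%R s /\ char_poly A = \prod_(x <- s) ('X - x%:P)].

(* The default [::] is only returned when char_poly A does not split over R,
   which spectrum_symP rules out for symmetric A. *)
Definition spectrum (R : realType) n (A : 'M[R]_n) : seq R :=
  xget [::] (ordered_spectrum A).

Lemma ordered_spectrum_uniq (R : realType) n (A : 'M[R]_n) s s' :
  ordered_spectrum A s -> ordered_spectrum A s' -> s = s'.
Proof.
move=> [ss sE] [ss' s'E]; apply: (sorted_eq le_trans le_anti ss ss').
by apply: prod_XsubC_eq; rewrite -sE -s'E.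
Qed.

Lemma spectrum_symP (R : realType) n (A : 'M[R]_n) : A^T = A ->
  ordered_spectrum A (spectrum A) /\ size (spectrum A) = n.
Proof.
move=> symA.
suff [s sP] : exists s, ordered_spectrum A s.
  have H : ordered_spectrum A (spectrum A) by apply: xgetI sP.
  split=> //; have [_ /(congr1 (size \o polyseq))/=] := H.
  by rewrite size_char_poly size_prod_XsubC => -[].
pose f := real_complex R.
pose B := map_mx f A.
have hermB : B \is hermsymmx.
  apply/is_hermitianmxP; rewrite expr0 scale1r.
  apply/matrixP => i j; rewrite !mxE -[in RHS]symA mxE.
  by rewrite -[Num.conj _]/(conjc _) /= /f /real_complex_def oppr0.
have /orthomx_spectralP BE := hermitian_normalmx hermB.
have /mxOverP dreal := hermitian_spectral_diag_real hermB.
set P := spectralmx B in BE; set d := spectral_diag B in BE dreal.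
have Pu : P \in unitmx := spectral_unit B.
have cB : char_poly B = \prod_i ('X - (d 0 i)%:P).
  have -> : char_poly B = char_poly (diag_mx d).
    rewrite /char_poly /char_poly_mx.
    set Q := map_mx polyC P.
    have Qu : Q \in unitmx.
      by rewrite unitmxE det_map_mx; apply: rmorph_unit; rewrite -unitmxE.
    have -> : 'X%:M - map_mx polyC B =
        invmx Q *m ('X%:M - map_mx polyC (diag_mx d)) *m Q.
      rewrite mulmxBr mulmxBl [in RHS]scalar_mxC mulmxKV //.
      congr (_ - _); rewrite {1}BE !map_mxM; congr (_ *m _ *m _).
      have H : map_mx polyC (invmx P) *m Q = 1%:M.
        by rewrite -map_mxM mulVmx // map_mx1.
      by rewrite -[LHS](mulmxK Qu) H mul1mx.
    by rewrite !det_mulmx mulrAC -det_mulmx mulVmx // det1 mul1r.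
  rewrite char_poly_trig ?diag_mx_is_trig //.
  by apply: eq_bigr => i _; rewrite !mxE eqxx mulr1n.
pose s0 := [seq complex.Re (d 0 i) | i <- enum 'I_n].
exists (sort <=%R s0); split; first exact: sort_sorted le_total _.
rewrite (perm_big s0) ?perm_sort //=; apply: (map_poly_inj f).
rewrite map_char_poly -/B cB map_prod_XsubC big_map big_enum /=.
apply: eq_bigr => i _; congr (_ - _%:P).
by rewrite /f /real_complex_def; have := dreal 0 i; case: (d 0 i) => x y;
  rewrite complex_real /= => /eqP ->.
Qed.

Definition offdiag (R : realType) (t : R) (n : nat) : R :=
  if odd n then 2 * `|cos (t / 2)| else 1.

(* Rows, columns and entries of v are numbered from 0 here and from 1 in the
   mathematical text, so that the entry (i, i+1) is a_(i+1). *)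
Definition jacobi (R : realType) p (t : R) (v : 'rV[R]_p) : 'M[R]_p :=
  \matrix_(i, j)
    if i == j then v 0 i
    else if j == i.+1 :> nat then offdiag t i.+1
    else if i == j.+1 :> nat then offdiag t j.+1
    else 0.

Lemma jacobi_sym (R : realType) p (t : R) (v : 'rV[R]_p) :
  (jacobi t v)^T = jacobi t v.
Proof.
apply/matrixP => i j; rewrite !mxE eq_sym; case: eqVneq => [->//|_].
by case: (eqVneq (i : nat) j.+1) => [->|//]; rewrite ltn_eqF.
Qed.

(* k : 'I_(2N+1) stands for the index k - N of the text, ranging over -N..N. *)
Definition lambda (R : realType) N (t : R) (v : 'rV[R]_N.*2.+1)
  (k : 'I_N.*2.+1) : R := (spectrum (jacobi t v))`_k.

Definition Psi (R : realType) N (v : 'rV[R]_N.*2.+1) : 'rV[R]_N.*2.+1 :=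
  \row_k lambda pi v k.

Definition hatV (R : realType) N (alpha : R) : set 'rV[R]_N.*2.+1 :=
  [set v | [/\ 0 <= v 0 ord0,
               forall i j : 'I_N.*2.+1, (i < j)%N -> v 0 i < v 0 j
             & v 0 ord_max <= alpha]].

Definition checkV (R : realType) N (alpha : R) : set 'rV[R]_N.*2.+1 :=
  [set v | [/\ v 0 ord0 <= alpha,
               forall i j : 'I_N.*2.+1, (i < j)%N -> v 0 j < v 0 i
             & 0 <= v 0 ord_max]].

Arguments hatV {R} N alpha _.
Arguments checkV {R} N alpha _.

(* Algorithms on real inputs are programs for a real-number machine in the
   sense of Blum-Shub-Smale, augmented with square roots: registers hold exact
   reals; rational constants, field operations, square roots, comparisons and
   loops are the only primitives. No real parameter can be hidden in the
   program text. *)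
Inductive cmd : Type :=
| Skip
| Const of nat & rat
| Add of nat & nat & nat
| Sub of nat & nat & nat
| Mul of nat & nat & nat
| Div of nat & nat & nat
| Sqrt of nat & nat
| Seq of cmd & cmd
| IfLe of nat & nat & cmd & cmd
| WhileLe of nat & nat & cmd.

Definition store (R : realType) := nat -> R.

Definition upd (R : realType) (s : store R) (r : nat) (x : R) : store R :=
  fun q => if q == r then x else s q.

(* The first argument of Const, ..., Sqrt is the target register. Division by
   zero and square roots of negative numbers block the machine, so that
   exec c s s' asserts a terminating, error-free run. *)
Inductive exec (R : realType) : cmd -> store R -> store R -> Prop :=
| exec_skip s : exec Skip s s
| exec_const s r q : exec (Const r q) s (upd s r (ratr q))
| exec_add s r a b : exec (Add r a b) s (upd s r (s a + s b))
| exec_sub s r a b : exec (Sub r a b) s (upd s r (s a - s b))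
| exec_mul s r a b : exec (Mul r a b) s (upd s r (s a * s b))
| exec_div s r a b : s b != 0 -> exec (Div r a b) s (upd s r (s a / s b))
| exec_sqrt s r a : 0 <= s a -> exec (Sqrt r a) s (upd s r (Num.sqrt (s a)))
| exec_seq s s1 s2 c d : exec c s s1 -> exec d s1 s2 -> exec (Seq c d) s s2
| exec_if_true s s' a b c d : s a <= s b ->
    exec c s s' -> exec (IfLe a b c d) s s'
| exec_if_false s s' a b c d : s b < s a ->
    exec d s s' -> exec (IfLe a b c d) s s'
| exec_while_true s s1 s2 a b c : s a <= s b ->
    exec c s s1 -> exec (WhileLe a b c) s1 s2 -> exec (WhileLe a b c) s s2
| exec_while_false s a b c : s b < s a -> exec (WhileLe a b c) s s.

Lemma exec_det (R : realType) c (s s1 s2 : store R) :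
  exec c s s1 -> exec c s s2 -> s1 = s2.
Proof.
move=> e1; elim: e1 s2 => {c s s1}.
- by move=> s s2 H; inversion H.
- by move=> s r q s2 H; inversion H.
- by move=> s r a b s2 H; inversion H.
- by move=> s r a b s2 H; inversion H.
- by move=> s r a b s2 H; inversion H.
- by move=> s r a b _ s2 H; inversion H.
- by move=> s r a _ s2 H; inversion H.
- move=> s s1 s2 c d _ IHc _ IHd s3 H; inversion H; subst; apply: IHd.
  by match goal with E : exec c s _ |- _ => rewrite (IHc _ E) end.
- move=> s s' a b c d le_ab _ IH s3 H; inversion H; subst; first exact: IH.
  by move: le_ab; rewrite leNgt => /negP[].
- move=> s s' a b c d lt_ba _ IH s3 H; inversion H; subst; last exact: IH.
  by move: lt_ba; rewrite ltNge => /negP[].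
- move=> s s1 s2 a b c le_ab _ IHc _ IHd s3 H; inversion H; subst.
    apply: IHd.
    by match goal with E : exec c s _ |- _ => rewrite (IHc _ E) end.
  by move: le_ab; rewrite leNgt => /negP[].
- move=> s a b c lt_ba s3 H; inversion H; subst => //.
  by move: lt_ba; rewrite ltNge => /negP[].
Qed.

Definition load (R : realType) p (x : 'rV[R]_p) : store R :=
  fun r => if insub r is Some i then x 0 i else 0.

(* Input: the eigenvalues in registers 0, ..., 2N, all others being 0.
   Output: v_1, ..., v_(2N+1) in registers 0, ..., 2N. *)
Definition recovers (R : realType) N (c : cmd) (V : set 'rV[R]_N.*2.+1) : Prop :=
  forall v, V v -> exists s : store R,
    exec c (load (Psi v)) s /\ forall i : 'I_N.*2.+1, s i = v 0 i.

(* Main.v *)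
Require Import Defs.
From mathcomp Require Import all_boot all_order all_algebra.
From mathcomp Require Import all_classical all_reals all_analysis.
From mathcomp Require Import ring lra zify.
Set Implicit Arguments.
Unset Strict Implicit.
Unset Printing Implicit Defensive.

Import Order.TTheory GRing.Theory Num.Theory.
Local Open Scope classical_set_scope.
Local Open Scope ring_scope.

(** At t = pi the odd-numbered off-diagonal entries vanish, so the Jacobi matrix
    splits into the 1 x 1 block v_1 and the 2 x 2 blocks with diagonal
    (x, y) = (v_2k, v_2k+1) and off-diagonal entry 1, whose eigenvalues are
    ((x + y) -+ sqrt ((x - y)^2 + 4)) / 2.  For monotone v in [0, 1] the lower
    ones are negative, the upper ones exceed 1, v_1 lies in between, and both
    eigenvalues increase strictly with (x, y).  The sorted spectrum therefore
    says which two eigenvalues belong to which block, and x and y are recovered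
    from their sum and the square of their difference.  Injectivity follows
    because the recovering program is deterministic.

    For alpha > 1 the lower eigenvalue of the first 2 x 2 block can be made
    nonnegative, and trading it with v_1 yields a second vector with the same
    spectrum.  Decreasing vectors are handled by v |-> alpha - v. *)

(** * Decoupled tridiagonal determinants and the characteristic polynomial at [pi] *)

Definition tridiag (S : nzRingType) (d e : nat -> S) n : 'M[S]_n :=
  \matrix_(i, j)
    if i == j then d i
    else if j == i.+1 :> nat then e i
    else if i == j.+1 :> nat then e j
    else 0.

(** The entry [e m] is the only coupling between the first [m.+1] indices and the rest, so the
    matrix is block diagonal. *)
Lemma det_tridiag_split (S : comNzRingType) (d e : nat -> S) m n :
  e m = 0 ->
  \det (tridiag d e (m.+1 + n)) =
  \det (tridiag d e m.+1) *
  \det (tridiag (fun i => d (m.+1 + i)%N) (fun i => e (m.+1 + i)%N) n).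
Proof.
move=> em0; rewrite -(@det_ublock _ _ _ _ 0); congr (\det _).
apply/matrixP => i j; rewrite !mxE.
case: splitP => i' i'E; rewrite !mxE; case: splitP => j' j'E; rewrite !mxE;
  rewrite -!val_eqE /= i'E j'E ?eqn_add2l // -?addnS ?eqn_add2l ?i'E ?j'E //=.
- have li := ltn_ord i'; case: eqP => [|_]; first by lia.
  case: eqP => [jE|_]; first by rewrite (_ : nat_of_ord i' = m) //; lia.
  by case: eqP => //; lia.
- have lj := ltn_ord j'; case: eqP => [|_]; first by lia.
  case: eqP => [|_]; first by lia.
  by case: eqP => // jE; rewrite (_ : nat_of_ord j' = m) //; lia.
Qed.

Lemma det_tridiag2 (S : comNzRingType) (d e : nat -> S) :
  \det (tridiag d e 2) = d 0 * d 1 - e 0 ^+ 2.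
Proof.
rewrite (expand_det_row _ ord0) !big_ord_recl big_ord0 /cofactor !det_mx11.
by rewrite !mxE /= expr0 expr1 !mul1r addr0 mulN1r mulrN expr2.
Qed.

Lemma det_tridiag_pairs (S : comNzRingType) (d e : nat -> S) N :
  (forall k, e k.*2.+1 = 0) ->
  \det (tridiag d e N.*2) =
  \prod_(k < N) (d k.*2 * d k.*2.+1 - e k.*2 ^+ 2).
Proof.
elim: N d e => [|N IH] d e e0; first by rewrite det_mx00 big_ord0.
rewrite -[N.+1.*2]/(2 + N.*2)%N det_tridiag_split ?(e0 0) // det_tridiag2.
rewrite IH => [|k]; first by rewrite big_ord_recl.
by rewrite (e0 k.+1).
Qed.

Definition entry (R : realType) p (v : 'rV[R]_p.+1) (i : nat) : R :=
  v 0 (inord i).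

(** The [- 1] is minus the square of the off-diagonal entry of a block. Taking a sequence rather
    than a row vector avoids bound proofs on indices. *)
Definition pi_poly (R : realType) N (f : nat -> R) : {poly R} :=
  ('X - (f 0)%:P) *
  \prod_(k < N) (('X - (f k.*2.+1)%:P) * ('X - (f k.*2.+2)%:P) - 1).

Lemma char_poly_jacobi_pi (R : realType) N (v : 'rV[R]_N.*2.+1) :
  char_poly (jacobi pi v) = pi_poly N (entry v).
Proof.
pose d i : {poly R} := 'X - (entry v i)%:P.
pose e i : {poly R} := - (offdiag pi i.+1)%:P.
have offE i : offdiag (pi : R) i = (~~ odd i)%:R.
  by rewrite /offdiag cos_pihalf normr0 mulr0; case: odd.
rewrite /char_poly (_ : char_poly_mx _ = tridiag d e N.*2.+1); last first.
  apply/matrixP => i j; rewrite !mxE /d /e /entry.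
  case: eqP => [->|_]; first by rewrite inord_val.
  by rewrite sub0r; do 2?case: eqP => // _; rewrite oppr0.
(* [e 0] comes from [offdiag pi 1 = 0], which splits off [v_1]; after this shift by one the zeros of
   [e] sit at odd positions, as [det_tridiag_pairs] requires. *)
rewrite -[N.*2.+1]/(1 + N.*2)%N det_tridiag_split; last first.
  by rewrite /e offE oppr0.
rewrite det_mx11 !mxE /= /pi_poly; congr (_ * _).
rewrite det_tridiag_pairs => [|k]; last by rewrite /e offE /= odd_double oppr0.
by apply: eq_bigr => k _; rewrite /e offE /= odd_double /= sqrrN expr1n.
Qed.

Lemma spectrumE (R : realType) n (A : 'M[R]_n) s :
  ordered_spectrum A s -> spectrum A = s.
Proof. by move=> As; apply: ordered_spectrum_uniq (As); apply: xgetI As. Qed.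

(** The spectrum is chosen from a set that depends on the matrix only through its characteristic
    polynomial, so no eigenvalue has to be computed or sorted. *)
Lemma Psi_pi_poly (R : realType) N (v w : 'rV[R]_N.*2.+1) :
  pi_poly N (entry v) = pi_poly N (entry w) -> Psi v = Psi w.
Proof.
rewrite -!char_poly_jacobi_pi => vw; apply/rowP => k; rewrite !mxE /lambda.
by rewrite /spectrum /ordered_spectrum vw.
Qed.

(** * Eigenvalues of a 2 x 2 block *)

Definition gap (R : realType) (x y : R) := Num.sqrt ((x - y) ^+ 2 + 4).
Definition eig_lo (R : realType) (x y : R) := (x + y - gap x y) / 2.
Definition eig_hi (R : realType) (x y : R) := (x + y + gap x y) / 2.

Lemma gap_sqr (R : realType) (x y : R) : gap x y ^+ 2 = (x - y) ^+ 2 + 4.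
Proof. by rewrite sqr_sqrtr // addr_ge0 ?sqr_ge0. Qed.

Lemma gap_ge2 (R : realType) (x y : R) : 2 <= gap x y.
Proof.
have g0 : 0 <= gap x y := sqrtr_ge0 _.
have : 2 ^+ 2 <= gap x y ^+ 2 by rewrite gap_sqr; have := sqr_ge0 (x - y); lra.
by rewrite ler_sqr ?nnegrE.
Qed.

Lemma norm_le_gap (R : realType) (x y : R) : `|x - y| <= gap x y.
Proof. by rewrite -sqrtr_sqr ler_wsqrtr // lerDl. Qed.

(** This makes both [x + y - gap x y] and [x + y + gap x y] strictly increasing. In the difference
    of the squared gaps the 4 cancels; dividing by the sum of the gaps, which bounds the sum of the
    two differences, leaves a quantity below the right-hand side. *)
Lemma gap_lt (R : realType) (x y x' y' : R) :
  x < x' -> y < y' -> `|gap x' y' - gap x y| < (x' - x) + (y' - y).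
Proof.
move=> xx yy; have := gap_ge2 x y; have := gap_ge2 x' y'.
have := gap_sqr x y; have := gap_sqr x' y'.
have := norm_le_gap x y; have := norm_le_gap x' y'.
move: (gap x y) (gap x' y') => g g' dg' dg g'E gE g'2 g2.
have K : (g' - g) * (g' + g) = (x' - y' - (x - y)) * (x' - y' + (x - y)).
  by rewrite -!subr_sqr gE g'E; ring.
have dlt : `|x' - y' - (x - y)| < (x' - x) + (y' - y) by rewrite ltr_norml; lra.
have slt : `|x' - y' + (x - y)| <= g' + g.
  by apply: le_trans (ler_normD _ _) _; apply: lerD.
have gg : 0 < g' + g by lra.
rewrite -(ltr_pM2r gg) -{1}(gtr0_norm gg) -normrM K normrM.
by apply: le_lt_trans (ler_wpM2l (normr_ge0 _) slt) _; rewrite ltr_pM2r.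
Qed.

Lemma eig_lo_lt (R : realType) (x y x' y' : R) :
  x < x' -> y < y' -> eig_lo x y < eig_lo x' y'.
Proof.
move=> xx yy; have := gap_lt xx yy; rewrite ltr_norml /eig_lo => /andP[].
by lra.
Qed.

Lemma eig_hi_lt (R : realType) (x y x' y' : R) :
  x < x' -> y < y' -> eig_hi x y < eig_hi x' y'.
Proof.
move=> xx yy; have := gap_lt xx yy; rewrite ltr_norml /eig_hi => /andP[].
by lra.
Qed.

(** Distinctness makes the gap exceed 2, while [x + y <= 2]. *)
Lemma eig_lo_lt0 (R : realType) (x y : R) :
  0 <= x <= 1 -> 0 <= y <= 1 -> x != y -> eig_lo x y < 0.
Proof.
move=> /andP[x0 x1] /andP[y0 y1] xy; rewrite /eig_lo.
have := gap_ge2 x y; have := gap_sqr x y.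
have : 0 < (x - y) ^+ 2 by rewrite exprn_even_gt0 //= subr_eq0.
nra.
Qed.

(** The gap is at least 2, and distinctness excludes [x = y = 0], so [x + y > 0]. *)
Lemma eig_hi_gt1 (R : realType) (x y : R) :
  0 <= x <= 1 -> 0 <= y <= 1 -> x != y -> 1 < eig_hi x y.
Proof.
move=> /andP[x0 x1] /andP[y0 y1] xy; rewrite /eig_hi.
have := gap_ge2 x y; suff : 0 < x + y by lra.
by rewrite lt_neqAle addr_ge0 // andbT eq_sym paddr_eq0 //;
  apply: contra xy => /andP[/eqP-> /eqP->].
Qed.

Lemma eig_factor (R : realType) (x y : R) :
  ('X - x%:P) * ('X - y%:P) - 1 =
  ('X - (eig_lo x y)%:P) * ('X - (eig_hi x y)%:P).
Proof.
have sE : eig_lo x y + eig_hi x y = x + y by rewrite /eig_lo /eig_hi; field.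
have pE : eig_lo x y * eig_hi x y = x * y - 1.
  have -> : eig_lo x y * eig_hi x y = ((x + y) ^+ 2 - gap x y ^+ 2) / 4.
    by rewrite /eig_lo /eig_hi; field.
  by rewrite gap_sqr; field.
have XE (a b : R) : ('X - a%:P) * ('X - b%:P) =
    'X ^+ 2 - (a + b)%:P * 'X + (a * b)%:P :> {poly R}.
  by rewrite polyCD polyCM; ring.
by rewrite !XE sE pE polyCB addrA.
Qed.

(** * Monotone vectors and their sorted spectrum at [pi] *)

Definition monoV (R : realType) (b : bool) N (alpha : R) :=
  if b then hatV N alpha else checkV N alpha.
Arguments monoV {R} b N alpha _.

Lemma monoV_sub (R : realType) b N (alpha beta : R) :
  alpha <= beta -> monoV b N alpha `<=` monoV b N beta.
Proof.
by move=> ab; case: b => v []; split=> //; apply: le_trans ab.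
Qed.

Lemma monoV_mono (R : realType) b N (alpha : R) v i j :
  monoV b N alpha v -> (i < j <= N.*2)%N ->
  if b then entry v i < entry v j else entry v j < entry v i.
Proof.
by case: b => -[_ vlt _] /andP[ij jN]; apply: vlt; rewrite !inordK //; lia.
Qed.

Lemma monoV_bounds (R : realType) b N (alpha : R) v i :
  monoV b N alpha v -> (i <= N.*2)%N -> 0 <= entry v i <= alpha.
Proof.
have e0 (w : 'rV[R]_N.*2.+1) : entry w 0 = w 0 ord0.
  by rewrite /entry; congr (w 0 _); apply: val_inj; rewrite /= inordK.
have eM (w : 'rV[R]_N.*2.+1) : entry w N.*2 = w 0 ord_max.
  by rewrite /entry; congr (w 0 _); apply: val_inj; rewrite /= inordK.
move=> Vv iN; have lo := monoV_mono Vv (i := 0) (j := i).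
have hi := monoV_mono Vv (i := i) (j := N.*2).
have {}lo : if b then entry v 0 <= entry v i else entry v i <= entry v 0.
  have [->|i0] := posnP i; first by case: b {Vv lo hi}.
  by have := lo (introT andP (conj i0 iN)); case: b {Vv lo hi} => /ltW.
have {}hi : if b then entry v i <= entry v N.*2 else entry v N.*2 <= entry v i.
  have [->|iM] := eqVneq i N.*2; first by case: b {Vv lo hi}.
  have : (i < N.*2 <= N.*2)%N by rewrite leqnn andbT ltn_neqAle iM.
  by move/hi; case: b {Vv lo hi} => /ltW.
rewrite e0 in lo; rewrite eM in hi.
case: b Vv lo hi => -[v0 _ va] lo hi; apply/andP; split.
- exact: le_trans lo.
- exact: le_trans va.
- exact: le_trans hi.
- exact: le_trans v0.
Qed.

(* For decreasing v the blocks contribute to the sorted spectrum in reverse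
   order. *)
Definition mirror (b : bool) N k := if b then k else (N.-1 - k)%N.

Lemma mirrorK b N k : (k < N)%N -> mirror b N (mirror b N k) = k.
Proof. by case: b => //=; lia. Qed.

Lemma mirror_lt b N k : (k < N)%N -> (mirror b N k < N)%N.
Proof. by case: b => //=; lia. Qed.

Definition pair_lo (R : realType) (f : nat -> R) k :=
  eig_lo (f k.*2.+1) (f k.*2.+2).
Definition pair_hi (R : realType) (f : nat -> R) k :=
  eig_hi (f k.*2.+1) (f k.*2.+2).

Definition pi_spectrum (R : realType) b N (f : nat -> R) : seq R :=
  mkseq (fun k => pair_lo f (mirror b N k)) N ++
  f 0%N :: mkseq (fun k => pair_hi f (mirror b N k)) N.

Lemma pairwise_mkseq (T : Type) (r : rel T) (g : nat -> T) n :
  (forall i j, (i < j < n)%N -> r (g i) (g j)) -> pairwise r (mkseq g n).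
Proof.
move=> gr; rewrite /mkseq pairwise_map.
apply: (@sub_in_pairwise _ [pred i | (i < n)%N] ltn).
- by move=> i j /= _ jn ij; apply: gr; rewrite ij.
- by apply/allP => i; rewrite mem_iota.
- by rewrite -(sorted_pairwise ltn_trans) iota_ltn_sorted.
Qed.

Lemma pi_spectrum_sorted (R : realType) b N (v : 'rV[R]_N.*2.+1) :
  monoV b N 1 v -> sorted <%R (pi_spectrum b N (entry v)).
Proof.
move=> Vv; set f := entry v; pose x k := f k.*2.+1; pose y k := f k.*2.+2.
have bnd k : (k < N)%N -> [/\ 0 <= x k <= 1, 0 <= y k <= 1 & x k != y k].
  move=> kN; split.
  - by apply: monoV_bounds Vv _; lia.
  - by apply: monoV_bounds Vv _; lia.
  have /(monoV_mono Vv) : (k.*2.+1 < k.*2.+2 <= N.*2)%N by lia.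
  by rewrite -/(x k) -/(y k) neq_lt; case: b Vv => _ ->; rewrite ?orbT.
have f0 : 0 <= f 0 <= 1 by apply: monoV_bounds Vv _; lia.
have lo0 k : (k < N)%N -> pair_lo f k < 0.
  by case/bnd => xk yk xyk; apply: eig_lo_lt0.
have hi1 k : (k < N)%N -> 1 < pair_hi f k.
  by case/bnd => xk yk xyk; apply: eig_hi_gt1.
have xy_lt i j : (i < j < N)%N ->
    x (mirror b N i) < x (mirror b N j) /\ y (mirror b N i) < y (mirror b N j).
  move=> ijN; case: b Vv => Vv /=.
    by split; apply: (monoV_mono Vv); lia.
  by split; apply: (monoV_mono Vv); lia.
rewrite (sorted_pairwise lt_trans) pairwise_cat /=; apply/and4P; split.
- apply/allrelP => u z /mapP[k]; rewrite mem_iota add0n => /= kN -> zs.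
  apply: lt_le_trans (lo0 _ (mirror_lt b kN)) _; case/andP: f0 => f0 _.
  move: zs; rewrite inE => /predU1P[->//|/mapP[j]].
  rewrite mem_iota add0n => /= jN ->; apply: ltW.
  exact: lt_trans ltr01 (hi1 _ (mirror_lt b jN)).
- by apply: pairwise_mkseq => i j /xy_lt[? ?]; apply: eig_lo_lt.
- apply/allP => z /mapP[j]; rewrite mem_iota add0n => /= jN ->.
  by case/andP: f0 => _ f1; apply: le_lt_trans f1 (hi1 _ (mirror_lt b jN)).
- by apply: pairwise_mkseq => i j /xy_lt[? ?]; apply: eig_hi_lt.
Qed.

Lemma pi_poly_factor (R : realType) b N (f : nat -> R) :
  pi_poly N f = \prod_(z <- pi_spectrum b N f) ('X - z%:P).
Proof.
rewrite /pi_poly big_cat big_cons /= !big_map mulrCA; congr (_ * _).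
have -> : iota 0 N = index_iota 0 N by rewrite /index_iota subn0.
rewrite (eq_bigr _ (fun k _ => eig_factor _ _)) !big_mkord -big_split /=.
(* In the decreasing case [mirror] only permutes the factors. *)
case: b => //=; rewrite (reindex_inj rev_ord_inj) /=.
by apply: eq_bigr => k _; rewrite /pair_lo /pair_hi subnS -subn1 subnAC subn1.
Qed.

Lemma spectrum_jacobi_pi (R : realType) b N (v : 'rV[R]_N.*2.+1) :
  monoV b N 1 v -> spectrum (jacobi pi v) = pi_spectrum b N (entry v).
Proof.
move=> Vv; apply: spectrumE; split.
  by apply: sub_sorted (pi_spectrum_sorted Vv) => x y; apply: ltW.
by rewrite char_poly_jacobi_pi -pi_poly_factor.
Qed.

Lemma lambda_pi_distinct (R : realType) b N (v : 'rV[R]_N.*2.+1) :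
  monoV b N 1 v ->
  forall k l : 'I_N.*2.+1, k != l -> lambda pi v k != lambda pi v l.
Proof.
move=> Vv k l kl; rewrite /lambda (spectrum_jacobi_pi Vv).
have sz : size (pi_spectrum b N (entry v)) = N.*2.+1.
  by rewrite size_cat /= !size_mkseq addnS addnn.
rewrite nth_uniq ?sz //.
exact: (sorted_uniq lt_trans (@ltxx _ _)) (pi_spectrum_sorted Vv).
Qed.

Lemma load_Psi_pi (R : realType) b N (v : 'rV[R]_N.*2.+1) r :
  monoV b N 1 v -> (r <= N.*2)%N ->
  load (Psi v) r = (pi_spectrum b N (entry v))`_r.
Proof.
move=> Vv rN; rewrite /load insubT //= mxE /lambda.
by rewrite (spectrum_jacobi_pi Vv).
Qed.

Lemma load_Psi_first (R : realType) b N (v : 'rV[R]_N.*2.+1) :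
  monoV b N 1 v -> load (Psi v) N = entry v 0.
Proof.
move=> Vv; rewrite (load_Psi_pi Vv); last by lia.
by rewrite nth_cat size_mkseq ltnn subnn.
Qed.

Lemma load_Psi_lo (R : realType) b N (v : 'rV[R]_N.*2.+1) k :
  monoV b N 1 v -> (k < N)%N ->
  load (Psi v) (mirror b N k) = pair_lo (entry v) k.
Proof.
move=> Vv kN; have mN := mirror_lt b kN; rewrite (load_Psi_pi Vv); last by lia.
by rewrite nth_cat size_mkseq mN nth_mkseq // mirrorK.
Qed.

Lemma load_Psi_hi (R : realType) b N (v : 'rV[R]_N.*2.+1) k :
  monoV b N 1 v -> (k < N)%N ->
  load (Psi v) (N.+1 + mirror b N k)%N = pair_hi (entry v) k.
Proof.
move=> Vv kN; have mN := mirror_lt b kN; rewrite (load_Psi_pi Vv); last by lia.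
rewrite nth_cat size_mkseq ifN; last by lia.
by rewrite addSn -addnS addKn /= nth_mkseq // mirrorK.
Qed.

(** * The recovering program and its correctness *)

Fixpoint foreach (c : nat -> cmd) n : cmd :=
  if n is n'.+1 then Seq (foreach c n') (c n') else Skip.

(* Registers from B on are scratch space; those in Q are the inputs shared by
   all the c i, and T i is the output register of c i. *)
Lemma exec_foreach (R : realType) (c : nat -> cmd) (T : nat -> nat)
    (Q : pred nat) (val : nat -> R) (B n : nat) (s0 : store R) :
  injective T ->
  (forall i, (i < n)%N -> (T i < B)%N /\ ~~ Q (T i)) ->
  (forall q, Q q -> (q < B)%N) ->
  (forall i (s : store R), (i < n)%N -> (forall q, Q q -> s q = s0 q) ->
     exists s', [/\ exec (c i) s s', s' (T i) = val i &
                 forall q, (q < B)%N -> q != T i -> s' q = s q]) ->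
  exists s, [/\ exec (foreach c n) s0 s,
               forall i, (i < n)%N -> s (T i) = val i &
               forall q, Q q -> s q = s0 q].
Proof.
move=> injT; elim: n => [|n IH] TB QB cP.
  by exists s0; split=> //; apply: exec_skip.
have [|||s [es sT sQ]] := IH.
- by move=> i /ltnW; apply: TB.
- exact: QB.
- by move=> i s /ltnW; apply: cP.
have [s' [es' s'T s'E]] := cP n s (ltnSn n) sQ.
exists s'; split; first exact: exec_seq es es'.
- move=> i; rewrite ltnS leq_eqVlt => /predU1P[->//|lt_in].
  rewrite s'E ?sT ?(inj_eq injT) ?ltn_eqF //.
  by have [] := TB i (ltnW lt_in).
- move=> q Qq; rewrite s'E ?sQ ?QB //.
  by apply: contraTneq Qq => ->; have [] := TB n (ltnSn n).
Qed.

(** The machine has no move instruction, so zero is loaded into scratch register [B] and added. *)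
Definition copy_cmd B (r a : nat) : cmd := Seq (Const B 0%R) (Add r a B).

Lemma exec_copy (R : realType) B r a (s : store R) : (a < B)%N ->
  exists s', [/\ exec (copy_cmd B r a) s s', s' r = s a &
              forall q, (q < B)%N -> q != r -> s' q = s q].
Proof.
move=> aB; eexists; split; first by apply: exec_seq; constructor.
  by rewrite /upd !eqxx (ltn_eqF aB) rmorph0 addr0.
by move=> q qB /negbTE qr; rewrite /upd qr (ltn_eqF qB).
Qed.

(* The diagonal entries of a 2 x 2 block with eigenvalues l and h are the roots
   of z^2 - (h + l) z + h l + 1; [plus] selects the larger one. *)
Definition root_cmd B (plus : bool) (r l h : nat) : cmd :=
  Seq (Defs.Sub B h l) (Seq (Mul B B B) (Seq (Const B.+1 4%R)
  (Seq (Defs.Sub B B B.+1) (Seq (Sqrt B B) (Seq (Add B.+1 h l) (Seq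
  (if plus then Add B B.+1 B else Defs.Sub B B.+1 B)
  (Seq (Const B.+1 2^-1) (Mul r B B.+1)))))))).

Lemma exec_root (R : realType) B plus r l h (s : store R) :
  (l < B)%N -> (h < B)%N -> 0 <= (s h - s l) ^+ 2 - 4 ->
  exists s', [/\ exec (root_cmd B plus r l h) s s',
     s' r = (s h + s l +
       (if plus then 1 else -1) * Num.sqrt ((s h - s l) ^+ 2 - 4)) / 2 &
     forall q, (q < B)%N -> q != r -> s' q = s q].
Proof.
move=> lB hB D0; have BS : (B.+1 == B) = false by rewrite gtn_eqF.
have SB : (B == B.+1) = false by rewrite ltn_eqF.
have E q : (q < B)%N -> (q == B) = false /\ (q == B.+1) = false.
  by move=> qB; rewrite !ltn_eqF // ltnW.
have [lB1 lB2] := E l lB; have [hB1 hB2] := E h hB.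
have r4 : ratr 4 = 4 :> R by rewrite rmorph_nat.
have r2 : ratr 2^-1 = 2^-1 :> R by rewrite fmorphV rmorph_nat.
eexists; split.
- do 4!(apply: exec_seq; first by constructor).
  apply: exec_seq.
    by constructor; rewrite /upd !eqxx ?(BS, SB, lB1, lB2, hB1, hB2) r4.
  apply: exec_seq; first by constructor.
  apply: exec_seq.
    (* Writing the sign as a factor gives one final store for both the [Add] and the [Sub]
       branch. *)
    instantiate (1 := upd _ B (_ + (if plus then 1 else -1) * _)).
    by case: plus; [rewrite mul1r|rewrite mulN1r]; constructor.
  by apply: exec_seq; constructor.
- rewrite /upd !eqxx ?(BS, SB, lB1, lB2, hB1, hB2) /= ?eqxx ?BS ?SB r4 r2.
  by rewrite expr2.
- move=> q qB /negbTE qr; have [qB1 qB2] := E q qB.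
  by rewrite /upd qr qB1 qB2.
Qed.

(** Results go first to registers [p + i], since each eigenvalue of a block is read twice; the
    second loop moves them down. The larger root belongs to the second entry of a block when [v]
    increases, to the first when it decreases: hence [odd i != b]. *)
Definition recover_cmd (b : bool) N : cmd :=
  let p := N.*2.+1 in let B := p.*2 in
  Seq
    (foreach (fun i => if i is j.+1 then
       root_cmd B (odd i != b) (p + i)
         (mirror b N j./2) (N.+1 + mirror b N j./2)
       else copy_cmd B (p + i) N) p)
    (foreach (fun i => copy_cmd B i (p + i)) p).

(** The discriminant of the quadratic solved by [root_cmd] is a square, so the machine never blocks
    at [Sqrt]. *)
Lemma pair_sqr_gap (R : realType) (f : nat -> R) k :
  (pair_hi f k - pair_lo f k) ^+ 2 - 4 = (f k.*2.+1 - f k.*2.+2) ^+ 2.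
Proof.
have -> : pair_hi f k - pair_lo f k = gap (f k.*2.+1) (f k.*2.+2).
  by rewrite /pair_hi /pair_lo /eig_hi /eig_lo; field.
by rewrite gap_sqr addrK.
Qed.

Lemma pair_sum (R : realType) (f : nat -> R) k :
  pair_hi f k + pair_lo f k = f k.*2.+1 + f k.*2.+2.
Proof. by rewrite /pair_hi /pair_lo /eig_hi /eig_lo; field. Qed.

Lemma recover_cmdP (R : realType) b N :
  recovers (recover_cmd b N) (monoV b N (1 : R)).
Proof.
move=> v Vv; set p := N.*2.+1; set B := p.*2; set s0 := load (Psi v).
have [|||i s iN sE|s1 [e1 s1E _]] :=
  @exec_foreach R (fun i => if i is j.+1 then
       root_cmd B (odd i != b) (p + i)
         (mirror b N j./2) (N.+1 + mirror b N j./2)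
       else copy_cmd B (p + i) N) (addn p) [pred q | (q < p)%N]
    (entry v) B p s0.
- exact: addnI.
- by move=> i ip /=; rewrite -leqNgt leq_addr /B -addnn ltn_add2l.
- by move=> q /= qp; rewrite /B -addnn ltn_addr.
- case: i iN => [|j] iN.
    have [|s' [es' s'r s'q]] := @exec_copy R B (p + 0) N s; first by lia.
    exists s'; split=> //; rewrite s'r sE /=; last by lia.
    exact: load_Psi_first Vv.
  set k := j./2; have kN : (k < N)%N by lia.
  have mN := mirror_lt b kN.
  have lE : s (mirror b N k) = pair_lo (entry v) k.
    by rewrite sE /=; [exact: load_Psi_lo|lia].
  have hE : s (N.+1 + mirror b N k)%N = pair_hi (entry v) k.
    by rewrite sE /=; [exact: load_Psi_hi|lia].
  have [|||s' [es' s'r s'q]] := @exec_root R B (odd j.+1 != b) (p + j.+1)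
    (mirror b N k) (N.+1 + mirror b N k) s;
    rewrite ?lE ?hE ?pair_sqr_gap ?sqr_ge0 //; try lia.
  (* The root is [|x - y|]; monotonicity gives the sign of [x - y], and the parity of [j] tells
     which entry of the block is computed. *)
  exists s'; split=> //; rewrite s'r lE hE pair_sqr_gap sqrtr_sqr pair_sum.
  have /(monoV_mono Vv) : (k.*2.+1 < k.*2.+2 <= N.*2)%N by lia.
  have : j.+1 = if odd j then k.*2.+2 else k.*2.+1.
    by rewrite -[j in LHS]odd_double_half -/k; case: odd.
  rewrite /=; case: (odd j) => ->; case: b {Vv lE hE mN es' s'r} => /= xy.
  + by rewrite ltr0_norm ?subr_lt0 //; field.
  + by rewrite gtr0_norm ?subr_gt0 //; field.
  + by rewrite ltr0_norm ?subr_lt0 //; field.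
  + by rewrite gtr0_norm ?subr_gt0 //; field.
(* The roles swap: the stored results are now the protected inputs, and the eigenvalues are
   overwritten. *)
have [|||i s iN sE|s2 [e2 s2E _]] :=
  @exec_foreach R (fun i => copy_cmd B i (p + i)) id
    [pred q | (p <= q < B)%N] (entry v) B p s1.
- exact: inj_id.
- by move=> i ip /=; split; lia.
- by move=> q /andP[].
- have [|s' [es' s'r s'q]] := @exec_copy R B i (p + i) s; first by lia.
  by exists s'; split=> //; rewrite s'r sE ?s1E //=; lia.
exists s2; split; first exact: exec_seq e1 e2.
by move=> i; rewrite s2E // /entry inord_val.
Qed.

Lemma recovers_inj (R : realType) N (c : cmd) (V : set 'rV[R]_N.*2.+1) :
  recovers c V -> set_inj V (@Psi R N).
Proof.
move=> cV v w; rewrite !inE => Vv Vw vw.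
have [s [es sE]] := cV v Vv; have [s' [es' s'E]] := cV w Vw.
rewrite vw in es; apply/rowP => i.
by rewrite -sE -s'E (exec_det es es').
Qed.

Lemma recovers_sub (R : realType) N (c : cmd) (V W : set 'rV[R]_N.*2.+1) :
  V `<=` W -> recovers c W -> recovers c V.
Proof. by move=> VW cW v /VW/cW. Qed.

(** * Symmetry about [t = pi] *)

Lemma lambda_sym (R : realType) N (k : 'I_N.*2.+1) (t : R)
    (v : 'rV[R]_N.*2.+1) : lambda (pi + t) v k = lambda (pi - t) v k.
Proof.
suff H n : offdiag (pi + t) n = offdiag (pi - t) n.
  rewrite /lambda (_ : jacobi (pi + t) v = jacobi (pi - t) v) //.
  by apply/matrixP => i j; rewrite !mxE !H.
rewrite /offdiag; case: odd => //; congr (2 * _).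
(* The two cosines are opposite, and only their absolute value enters the matrix. *)
rewrite (_ : (pi + t) / 2 = pi - (pi - t) / 2); last by field.
by rewrite cosB cospi sinpi mul0r addr0 mulN1r normrN.
Qed.

(** * Failure of injectivity for [alpha > 1] *)

Definition reflect_seq (R : realType) b (alpha : R) (f : nat -> R) i : R :=
  if b then f i else alpha - f i.

Lemma monoV_row (R : realType) b N (alpha : R) (f : nat -> R) :
  (forall i, f i < f i.+1) -> 0 <= f 0%N -> (forall i, f i <= alpha) ->
  monoV b N alpha (\row_(i < N.*2.+1) reflect_seq b alpha f i).
Proof.
move=> /(homo_ltn lt_trans) fS f0 fa.
have fge0 i : 0 <= f i.
  by case: i => // i; apply: le_trans f0 (ltW (fS _ _ _)).
by case: b; split=> [|i j ij|]; rewrite !mxE /reflect_seq ?fS //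
  ?ltrD2l ?ltrN2 ?fS // ?gerBl ?subr_ge0.
Qed.

Lemma pi_poly_row (R : realType) N (f : nat -> R) :
  pi_poly N (entry (\row_(i < N.*2.+1) f i)) = pi_poly N f.
Proof.
have E i : (i <= N.*2)%N -> entry (\row_(i < N.*2.+1) f i) i = f i.
  by move=> iN; rewrite /entry mxE inordK.
rewrite /pi_poly E //; congr (_ * _); apply: eq_bigr => k _.
by have kN := ltn_ord k; rewrite !E //; lia.
Qed.

(* Both sides are Z (Z - b) (Z - p - q): the 1 x 1 block can trade its
   eigenvalue with the lower eigenvalue of the first 2 x 2 block. *)
Lemma twin_blocks (S : comNzRingType) (Z b p q p' q' : S) :
  p * q = 1 -> p' * q' = 1 -> b = p + q - p' - q' ->
  (Z - b) * ((Z - p) * (Z - q) - 1) =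
  (Z - 0) * ((Z - (b + p')) * (Z - (b + q')) - 1).
Proof.
move=> pq pq' bE.
have -> : (Z - p) * (Z - q) - 1 = Z * (Z - p - q).
  by rewrite -[1 in LHS]pq; ring.
have -> : (Z - (b + p')) * (Z - (b + q')) - 1 = (Z - b) * (Z - b - p' - q').
  by rewrite -[1 in LHS]pq'; ring.
by rewrite bE; ring.
Qed.

(** The tail is not shifted: [w] is read from index 3 on. Twin vectors share it, so their remaining
    blocks agree. *)
Definition prepend3 (R : realType) (x0 x1 x2 : R) (w : nat -> R)
    (i : nat) : R :=
  match i with 0 => x0 | 1 => x1 | 2 => x2 | _ => w i end.

Lemma pi_poly_twin (R : realType) b N (alpha B p q p' q' : R) w :
  (1 <= N)%N -> p * q = 1 -> p' * q' = 1 -> B = p + q - p' - q' ->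
  pi_poly N (reflect_seq b alpha (prepend3 B p q w)) =
  pi_poly N (reflect_seq b alpha (prepend3 0 (B + p') (B + q') w)).
Proof.
case: N => // N _ pq pq' BE.
rewrite /pi_poly !big_ord_recl !mulrA; congr (_ * _).
have pqP : p%:P * q%:P = 1 :> {poly R} by rewrite -polyCM pq.
have pqP' : p'%:P * q'%:P = 1 :> {poly R} by rewrite -polyCM pq'.
have BP : B%:P = p%:P + q%:P - p'%:P - q'%:P by rewrite BE !polyCB polyCD.
rewrite /reflect_seq /=; case: b; rewrite ?polyCB !polyCD.
  exact: twin_blocks.
(* Reflection amounts to [twin_blocks] at [Z = alpha - 'X], the signs cancelling in both blocks. *)
have nZ (x y : {poly R}) : 'X - (x - y) = - (x - 'X - y) by ring.
by rewrite !nZ !mulNr !mulrN !opprK (twin_blocks _ pqP pqP' BP) polyC0.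
Qed.

(** Up to reflection, a block with diagonal [(1/q, q)] has eigenvalues 0 and [1/q + q]. Shifting the
    block of [(1/r, r)] by [B] gives [B] and [B + 1/r + r]; the choice of [B] equates the larger
    ones, so first entries [B] and 0 can be exchanged. *)
Lemma Psi_not_inj (R : realType) b N (alpha : R) :
  (1 <= N)%N -> 1 < alpha -> ~ set_inj (monoV b N alpha) (@Psi R N).
Proof.
move=> N1 a1.
(* The bound [q < 2] yields [q - r < 1/r], that is [B < p]. *)
have [q [r [r1 rq qa q2]]] : exists q r : R,
    [/\ 1 < r, r < q, q < alpha & q < 2].
  have [a2|a2] := leP alpha 2.
    by exists ((1 + alpha) / 2), ((3 + alpha) / 4); split; lra.
  by exists (3 / 2), (5 / 4); split; lra.
have qV : q^-1 * q = 1 by rewrite mulVf // gt_eqF //; lra.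
have rV : r^-1 * r = 1 by rewrite mulVf // gt_eqF //; lra.
set p := q^-1 in qV *; set p' := r^-1 in rV *.
have p0 : 0 < p by rewrite invr_gt0; lra.
have p'0 : 0 < p' by rewrite invr_gt0; lra.
have pp' : p < p' by rewrite ltf_pV2 ?posrE; lra.
have p'1 : p' < 1 by rewrite invf_lt1; lra.
pose B := p + q - p' - r.
have B0 : 0 < B.
  (* Positivity of [B] says that [z + 1/z] increases beyond 1. *)
  have -> : B = (q - r) * (1 - p * p').
    rewrite /B mulrBr mulr1 mulrBl [q * _]mulrA [q * p]mulrC qV mul1r.
    by rewrite [p * p']mulrC mulrA [r * p']mulrC rV mul1r; ring.
  by rewrite mulr_gt0 ?subr_gt0 //; nra.
have Bp : B < p by rewrite /B; nra.
(* From index 3 on, [w] increases strictly from above [q] and stays below [alpha], so one sequence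
   serves every [N]. *)
pose w i : R := alpha - (alpha - q) / i%:R.
have wS i : w i.+3 < w i.+4.
  rewrite /w ltrD2l ltrN2 ltr_pM2l ?subr_gt0 // ltf_pV2 ?posrE ?ltr0n //.
  by rewrite ltr_nat.
have wa i : w i.+3 <= alpha.
  by rewrite /w gerBl divr_ge0 // subr_ge0 ltW.
have qw : q < w 3 by rewrite /w; lra.
pose f := prepend3 B p q w; pose g := prepend3 0 (B + p') (B + r) w.
have Vf : monoV b N alpha (\row_(i < N.*2.+1) reflect_seq b alpha f i).
  apply: monoV_row => [[|[|[|i]]]||[|[|[|i]]]] //=; lra.
have Vg : monoV b N alpha (\row_(i < N.*2.+1) reflect_seq b alpha g i).
  apply: monoV_row => [[|[|[|i]]]||[|[|[|i]]]] //=; rewrite /B; lra.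
move=> /(_ _ _ (mem_set Vf) (mem_set Vg)) fg.
have /fg/rowP/(_ ord0) : Psi (\row_(i < N.*2.+1) reflect_seq b alpha f i) =
    Psi (\row_(i < N.*2.+1) reflect_seq b alpha g i).
  by apply: Psi_pi_poly; rewrite !pi_poly_row; apply: pi_poly_twin.
rewrite !mxE /reflect_seq /=; case: b {Vf Vg fg} => [|/addrI/oppr_inj] BE.
all: by rewrite BE ltxx in B0.
Qed.

Lemma Psi_inj_iff (R : realType) b N (alpha : R) :
  (1 <= N)%N -> 0 <= alpha ->
  set_inj (monoV b N alpha) (@Psi R N) <-> 0 <= alpha <= 1.
Proof.
move=> N1 a0; split=> [inj|/andP[_ a1]].
  by rewrite a0 leNgt; apply/negP => /(Psi_not_inj N1) /(_ inj).
apply: (@recovers_inj _ _ (recover_cmd b N)).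
exact: recovers_sub (monoV_sub a1) (@recover_cmdP R b N).
Qed.

Theorem theorem1p7 (R : realType) (N : nat) (alpha : R)
    (N_ge1 : (1 <= N)%N) (alpha_ge0 : 0 <= alpha) :
  [/\ (* (i) *)
      set_inj (hatV N alpha) (@Psi R N) <-> 0 <= alpha <= 1,
      (* (ii) *)
      set_inj (checkV N alpha) (@Psi R N) <-> 0 <= alpha <= 1,
      (* (iii) *)
      0 <= alpha <= 1 ->
        (exists c : cmd, recovers c (hatV N alpha)) /\
        (exists c : cmd, recovers c (checkV N alpha)) &
      (* (iv) *)
      (forall (k : 'I_N.*2.+1) (t : R) (v : 'rV[R]_N.*2.+1),
         0 <= t <= pi -> lambda (pi + t) v k = lambda (pi - t) v k) /\
      (forall v : 'rV[R]_N.*2.+1, hatV N 1 v \/ checkV N 1 v ->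
         forall k l : 'I_N.*2.+1, k != l -> lambda pi v k != lambda pi v l)].
Proof.
split; [exact: (Psi_inj_iff true)|exact: (Psi_inj_iff false)| |split].
- move=> /andP[_ a1]; split.
    exists (recover_cmd true N).
    exact: recovers_sub (monoV_sub (b := true) a1) (@recover_cmdP R true N).
  exists (recover_cmd false N).
  exact: recovers_sub (monoV_sub (b := false) a1) (@recover_cmdP R false N).
- by move=> k t v _; apply: lambda_sym.
- by move=> v [Vv|Vv]; [apply: (@lambda_pi_distinct _ true)|
    apply: (@lambda_pi_distinct _ false)].
Qed.
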